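(* Let $B=(V,E)$ be a finite bipartite multigraph with at least one edge, and let $t\in\mathbb{N}$. Then $$\chi_{\mathrm{OL}}^t(B)\,=\,\chi^t(B)\,=\,\chi'(B)+2t\,=\,\Delta(B)+2t.$$
   Context: $\mathbb{N}=\{0,1,2,\dots\}$, $\mathbb{Z}^+=\{1,2,\dots\}$, and $\mathcal{P}(\mathbb{Z}^+)$ is the power set of $\mathbb{Z}^+$. A multigraph $G=(V,E)$ may have several parallel edges between two vertices, but every edge $uv=\{u,v\}$ has two distinct ends. $\Delta(G)$ is the maximal degree (edges counted with multiplicity). An edge coloring is a map $c'\colon E\to\{1,\dots,m\}$ with $c'(e)\neq c'(f)$ for any two distinct edges $e,f$ sharing at least one end; $\chi'(G)$ (chromatic index) is the smallest $m\in\mathbb{Z}^+$ for which such a map exists. Pre-fixed version: for a multi-labeling $c\colon V\to\mathcal{P}(\mathbb{Z}^+)$, an edge coloring $c'$ avoids $c$ if $c'(e)\notin\bigcup_{v\in e}c(v)$ for every $e\in E$. $\chi'_c(G)$ is the smallest $m\in\mathbb{Z}^+$ for which there is an edge coloring $c'\colon E\to\{1,\dots,m\}$ that avoids $c$. A $t$-labeling is a multi-labeling $c$ with $|c(v)|\le t$ for all $v\in V$. The $t$-avoiding chromatic index is $\chi^t(G):=\max\{\chi'_c(G) : c \text{ is a } t\text{-labeling}\}$. On-line version: for $t\colon V\to\mathbb{N}$ (a number $t\in\mathbb{N}$ being regarded as a constant function) let $\operatorname{supp}(t)=\{v\in V : t(v)\neq0\}$; for $U\subseteq V$ let $\mathsf{1}_U\colon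 V\to\{0,1\}$ be the indicator function of $U$. A set of edges is independent if its members are pairwise disjoint (no two share an end). $G-U$ is obtained by deleting the vertices in $U$ and all edges incident with them; $G-F$ by deleting the edges in $F$. For $m\in\mathbb{N}$, being on-line $t$-avoiding edge $m$-colorable is defined recursively: (i) if $m=0$, then $G$ is on-line $t$-avoiding edge $m$-colorable if $E=\emptyset$; (ii) if $m>0$, then $G$ is on-line $t$-avoiding edge $m$-colorable if for every subset $U\subseteq\operatorname{supp}(t)$ there exists an independent subset $F\subseteq E(G-U)$ such that $G-F$ is on-line $(t-\mathsf{1}_U)$-avoiding edge $(m-1)$-colorable. The on-line $t$-avoiding chromatic index $\chi_{\mathrm{OL}}^t(G)$ is the smallest $m\in\mathbb{N}$ such that $G$ is on-line $t$-avoiding edge $m$-colorable. *)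

(* Defs.v *)
From mathcomp Require Import boolp classical_sets functions cardinality.
From mathcomp Require Import all_boot.

Set Implicit Arguments.
Unset Strict Implicit.
Unset Printing Implicit Defensive.

(* Smallest and largest element of a set of natural numbers; the value is 0
   when there is none.  [least_spec] and [greatest_spec] give the usual
   characterizations, and every set to which these operators are applied in
   the theorem is shown below to satisfy their hypotheses. *)
Definition least (P : set nat) : nat :=
  xget 0 [set m | P m /\ forall k, P k -> m <= k]%classic.

Definition greatest (P : set nat) : nat :=
  xget 0 [set m | P m /\ forall k, P k -> k <= m]%classic.

Lemma least_spec (P : set nat) :
  (exists m, P m) -> P (least P) /\ forall k, P k -> least P <= k.
Proof.
move=> [m Pm]; rewrite /least.
have exP : exists n, `[< P n >] by exists m; apply/asboolP.
case: (ex_minnP exP) => n /asboolP Pn nmin.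
apply: (@xgetPex _ 0 [set m | P m /\ forall k, P k -> m <= k]%classic).
by exists n; split=> // k Pk; apply: nmin; apply/asboolP.
Qed.

Lemma greatest_spec (P : set nat) (b : nat) :
  (exists m, P m) -> (forall k, P k -> k <= b) ->
  P (greatest P) /\ forall k, P k -> k <= greatest P.
Proof.
move=> [m Pm] Pb; rewrite /greatest.
have exP : exists n, `[< P n >] by exists m; apply/asboolP.
have bP n : `[< P n >] -> n <= b by move=> /asboolP; apply: Pb.
case: (ex_maxnP exP bP) => n /asboolP Pn nmax.
apply: (@xgetPex _ 0 [set m | P m /\ forall k, P k -> k <= m]%classic).
by exists n; split=> // k Pk; apply: nmax; apply/asboolP.
Qed.

(* Finite multigraphs: parallel edges are distinct elements of [edge G] with
   the same pair of ends. *)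
Record multigraph := Multigraph {
  vertex : finType;
  edge : finType;
  ends : edge -> {set vertex};
  card_ends : forall e, #|ends e| = 2
}.

Section Multigraph.
Variable G : multigraph.
Implicit Types (U : {set vertex G}) (F : {set edge G}).

Definition degree (v : vertex G) : nat := #|[set e | v \in @ends G e]|.

Definition max_degree : nat := \max_(v : vertex G) degree v.

Definition bipartite : Prop :=
  exists X : {set vertex G}, forall e : edge G,
    #|ends e :&: X| = 1 /\ #|ends e :&: ~: X| = 1.

Definition edge_coloring (m : nat) (col : edge G -> nat) : Prop :=
  (forall e, 1 <= col e <= m) /\
  (forall e f, e != f -> ~~ [disjoint ends e & ends f] -> col e <> col f).

Definition chromatic_index : nat :=
  least [set m | 0 < m /\ exists col, edge_coloring m col]%classic.

Definition multilabeling (c : vertex G -> set nat) : Prop :=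
  forall v, (c v `<=` [set k | 0 < k])%classic.

Definition avoids (c : vertex G -> set nat) (col : edge G -> nat) : Prop :=
  forall e, ~ (\bigcup_(v in [set v | v \in ends e]) c v)%classic (col e).

Definition avoiding_index (c : vertex G -> set nat) : nat :=
  least [set m | 0 < m /\
    exists col, edge_coloring m col /\ avoids c col]%classic.

Definition t_labeling (t : nat) (c : vertex G -> set nat) : Prop :=
  multilabeling c /\ forall v, (c v #<= `I_t)%card.

Definition t_avoiding_index (t : nat) : nat :=
  greatest [set k | exists2 c, t_labeling t c & k = avoiding_index c]%classic.

Definition supp (t : vertex G -> nat) : {set vertex G} := [set v | t v != 0].

Definition sub_indicator (t : vertex G -> nat) U : vertex G -> nat :=
  fun v => t v - (v \in U).

Definition independent F : Prop :=
  {in F &, forall e f, e != f -> [disjoint ends e & ends f]}.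

(* The edge set of G - U, as a subset of that of G. *)
Definition edges_outside U : {set edge G} := [set e | [disjoint ends e & U]].

Definition del_edges F : multigraph :=
  @Multigraph (vertex G) {e : edge G | e \notin F}
    (fun e => ends (val e)) (fun e => card_ends (val e)).

End Multigraph.

Fixpoint online_colorable (m : nat) (G : multigraph) (t : vertex G -> nat) :
    Prop :=
  if m is m'.+1 then
    forall U : {set vertex G}, U \subset supp t ->
      exists F : {set edge G},
        [/\ F \subset edges_outside U, independent F &
            @online_colorable m' (del_edges F) (sub_indicator t U)]
  else #|edge G| = 0.

Definition online_index (G : multigraph) (t : vertex G -> nat) : nat :=
  least [set m | online_colorable m t]%classic.

Section WellDefined.

Lemma t_labeling_colorable (G : multigraph) (t : nat) (c : vertex G -> set nat)
    (m := #|vertex G| * t + #|edge G|) :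
  t_labeling t c -> exists col, edge_coloring m.+1 col /\ avoids c col.
Proof.
move=> [_ ct].
pose A v := [set i : 'I_m | `[< c v i.+1 >]].
have cardA v : #|A v| <= t.
  have /ppcard_leP[f] := ct v.
  have mapA : {subset map (fun i : 'I_m => f i.+1) (enum (A v)) <= iota 0 t}.
    move=> _ /mapP[i iA ->]; rewrite mem_iota /= add0n.
    by move: iA; rewrite mem_enum inE => /asboolP; apply: (@funS _ _ _ _ f).
  rewrite cardE -(size_map (fun i : 'I_m => f i.+1)) -[leqRHS](size_iota 0).
  apply: uniq_leq_size => //.
  rewrite map_inj_in_uniq ?enum_uniq // => i j.
  rewrite !mem_enum !inE => /asboolP ci /asboolP cj fij; apply: val_inj.
  apply: succn_inj.
  by apply: (@inj _ _ _ f) => //; apply: mem_set.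
pose B := ~: \bigcup_v A v.
have cardB : #|edge G| <= #|B|.
  have leU : #|\bigcup_v A v| <= #|vertex G| * t.
    rewrite -sum_nat_const.
    elim/big_rec2: _ => [|v n D _ IH]; first by rewrite cards0.
    by rewrite (leq_trans (leq_card_setU _ _)) // leq_add.
  have := cardsC (\bigcup_v A v); rewrite -/B card_ord => eqm.
  rewrite -(leq_add2l #|\bigcup_v A v|) eqm leq_add2r.
  exact: leU.
pose h e : 'I_m := enum_val (widen_ord cardB (enum_rank e)).
exists (fun e => (h e).+1); split; first split.
- by move=> e /=; rewrite ltnS ltnW.
- move=> e f ef _ [hef]; case/eqP: ef; apply: enum_rank_inj.
  by have /enum_val_inj/(congr1 val)/= := val_inj hef; apply: val_inj.
- move=> e [v _ /= cve]; have : h e \in B by apply: enum_valP.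
  by rewrite inE => /bigcupP[]; exists v => //; rewrite inE; apply/asboolP.
Qed.

Lemma chromatic_index_wd (G : multigraph) :
  exists m, 0 < m /\ exists col : edge G -> nat, edge_coloring m col.
Proof.
have [|col [colP _]] := @t_labeling_colorable G 0 (fun=> classical_sets.set0).
  by split=> v //; rewrite card_le0.
by eexists; split; last by exists col; apply: colP.
Qed.

Lemma avoiding_index_wd (G : multigraph) (t : nat) (c : vertex G -> set nat) :
  t_labeling t c ->
  exists m, 0 < m /\ exists col, edge_coloring m col /\ avoids c col.
Proof.
by move=> /t_labeling_colorable[col colP]; eexists; split; last by exists col;
  apply: colP.
Qed.

Lemma t_avoiding_index_ex (G : multigraph) (t : nat) :
  exists k, exists2 c : vertex G -> set nat, t_labeling t c &
    k = avoiding_index c.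
Proof.
exists (avoiding_index (fun _ : vertex G => classical_sets.set0)).
by exists (fun=> classical_sets.set0) => //; split=> v //; exact: card_le_emptyl.
Qed.

Lemma t_avoiding_index_bound (G : multigraph) (t k : nat) :
  (exists2 c : vertex G -> set nat, t_labeling t c & k = avoiding_index c) ->
  k <= (#|vertex G| * t + #|edge G|).+1.
Proof.
move=> [c ct ->]; have [_ min] := least_spec (avoiding_index_wd ct).
by apply: min; split=> //; exact: t_labeling_colorable.
Qed.

Lemma card_del_edges (G : multigraph) (F : {set edge G}) :
  #|edge (del_edges F)| = #|edge G| - #|F|.
Proof. by rewrite /= card_sig -(cardsC F) addKn; apply: eq_card => e; rewrite !inE. Qed.

Lemma online_colorable_edgeless (m : nat) (G : multigraph)
    (t : vertex G -> nat) : #|edge G| = 0 -> online_colorable m t.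
Proof.
elim: m G t => [//|m IH] G t E0 U _; exists set0; split; first exact: sub0set.
  by move=> e f; rewrite inE.
by apply: IH; rewrite card_del_edges E0.
Qed.

Lemma online_index_wd (G : multigraph) (t : vertex G -> nat) :
  exists m, online_colorable m t.
Proof.
exists (\sum_v t v + #|edge G|).
move: (leqnn (\sum_v t v + #|edge G|)); move: {2 3}(_ + _) => n.
elim: n G t => [|n IH] G t.
  by rewrite leqn0 addn_eq0 => /andP[_ /eqP].
move=> len; case: (posnP #|edge G|) => [|Epos].
  exact: online_colorable_edgeless.
move=> U Ut; have [U0 | [u uU]] := set_0Vmem U.
  have [e _] := card_gt0P Epos; exists [set e]; split.
  - by apply/subsetP => f _; rewrite inE U0 disjoint_sym disjoints_subset sub0set.
  - by move=> f g; rewrite !inE => /eqP-> /eqP->; rewrite eqxx.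
  apply: IH; rewrite card_del_edges cards1 /= -ltnS.
  apply: leq_trans len; rewrite -addnS subn1 prednK // leq_add2r.
  by apply: leq_sum => v _; apply: leq_subr.
exists set0; split; first exact: sub0set.
  by move=> e f; rewrite inE.
apply: IH; rewrite card_del_edges cards0 subn0 /= -ltnS.
apply: leq_trans len; rewrite -addSn leq_add2r.
rewrite (bigD1 u) // [leqRHS](bigD1 u) //= -addSn leq_add //.
  have /subsetP/(_ _ uU) := Ut; rewrite inE -lt0n => tu.
  by rewrite /sub_indicator uU subn1 prednK.
by apply: leq_sum => v _; apply: leq_subr.
Qed.

End WellDefined.

(* Main.v *)
From mathcomp Require Import boolp classical_sets functions cardinality.
Require Import Defs.
From mathcomp Require Import all_boot zify.

Set Implicit Arguments.
Unset Strict Implicit.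
Unset Printing Implicit Defensive.

(** Lower bound: give the labels [1, ..., t] to a vertex [v] of maximal degree
    and [t+1, ..., 2t] to all other vertices; the edges at [v] then need
    [max_degree] colors above [2t].  An off-line labeling is played on-line by
    presenting, in round [i], the set of the vertices whose label contains [i],
    so the on-line index is at least the off-line one.  Upper bound: this is
    Galvin's argument.  By König's theorem (Kempe chains) there is a proper
    coloring [k] with [max_degree] colors; let each edge be beaten by the edges
    of smaller color at its end on one side and by those of larger color at its
    end on the other side.  Every edge is beaten by fewer than [max_degree]
    edges, and each round the edges avoiding [U] have a kernel [F], a stable
    matching.  An edge that survives the round has either lost a unit of [t] at
    one of its ends or one of the edges beating it. *)

(** * Counting colors, and the last step of a path *)

Lemma card_le_range (T : finType) (S : {set T}) (k : T -> nat) (a n : nat) :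
  {in S &, injective k} -> {in S, forall e, a <= k e < a + n} -> #|S| <= n.
Proof.
move=> kinj kS; rewrite cardE -(size_map k) -[leqRHS](size_iota a).
apply: uniq_leq_size.
  by rewrite map_inj_in_uniq ?enum_uniq // => i j; rewrite !mem_enum; apply: kinj.
by move=> _ /mapP[e eS ->]; rewrite mem_iota; apply: kS; rewrite -mem_enum.
Qed.

Lemma exists_missing_color (T : finType) (S : {set T}) (k : T -> nat) (D : nat) :
  #|S| < D -> exists2 a, a < D & {in S, forall e, k e <> a}.
Proof.
move=> ltSD; pose s := map k (enum S).
have /allPn[a] : ~~ all (mem s) (iota 0 D).
  apply/negP => /allP sub; have := uniq_leq_size (iota_uniq 0 D) sub.
  by rewrite size_iota size_map -cardE leqNgt ltSD.
rewrite mem_iota => aD /negP as_; exists a => // e eS kea; apply: as_.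
by rewrite -kea; apply: map_f; rewrite mem_enum.
Qed.

Lemma connect_last_step (T : finType) (r : rel T) (u v : T) :
  connect r u v -> v = u \/ exists2 w, connect r u w & r w v.
Proof.
case/connectP => p; case: (lastP p) => [|q z]; first by left.
rewrite rcons_path last_rcons => /andP[pq rz] ->; right.
by exists (last u q) => //; apply/connectP; exists q.
Qed.

(** * König's edge coloring theorem and kernels of edge sets *)

Section BipartiteEdges.

Variables (E V W : finType) (x : E -> V) (y : E -> W).

Definition proper_on (A : {set E}) (k : E -> nat) : Prop :=
  {in A &, forall f g, x f = x g -> k f = k g -> f = g} /\
  {in A &, forall f g, y f = y g -> k f = k g -> f = g}.

(* [S] is the [x]-side of the chain of colors [a] and [b] from [x e]: leaving
   [x]-vertices by [b] and [y]-vertices by [a], the chain enters every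
   [y]-vertex by color [b] and so never meets [y e]. *)
Lemma proper_extend (A : {set E}) (e : E) (D : nat) (k : E -> nat) :
  e \notin A ->
  #|[set f | x f == x e]| <= D -> #|[set f | y f == y e]| <= D ->
  (forall f, f \in A -> k f < D) -> proper_on A k ->
  exists k' : E -> nat, (forall f, f \in e |: A -> k' f < D) /\ proper_on (e |: A) k'.
Proof.
move=> eA dx dy kD [px py].
(* The edge [e] is itself uncolored, so fewer than [D] colored edges meet either of its ends and
   some color is free there. *)
have missing (T : finType) (z : E -> T) : #|[set f | z f == z e]| <= D ->
    exists2 a, a < D & forall f, f \in A -> z f = z e -> k f <> a.
  move=> dz; have [|a aD ha] := @exists_missing_color _ [set f in A | z f == z e] k D.
    apply: leq_trans dz; apply: proper_card; apply/properP; split.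
      by apply/subsetP => f; rewrite !inE => /andP[].
    by exists e; rewrite !inE ?eqxx // (negPf eA).
  by exists a => // f fA zf; apply: ha; rewrite inE fA zf eqxx.
have [a aD ha] := missing _ x dx; have [b bD hb] := missing _ y dy.
pose r := [rel u v | [exists f in A, exists g in A,
  [&& x f == u, k f == b, y f == y g, k g == a & x g == v]]].
pose S := connect r (x e).
(* Since [a] is free at [x e], the chain reaches [x g] by a genuine last step; that step ends with
   an edge of color [a] at [x g], which can only be [g]. *)
have Sa g : g \in A -> k g = a -> S (x g) ->
    exists h, [/\ h \in A, k h = b, y h = y g & S (x h)].
  move=> gA kg /connect_last_step [/(ha g gA)//|[w Sw]].
  move=> /exists_inP[h hA /exists_inP[g' gA' /and5P[/eqP xh /eqP kh /eqP yh /eqP kg' /eqP xg']]].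
  have gg : g' = g by apply: px => //; rewrite kg'.
  by exists h; rewrite kh yh gg xh.
have Sb f g : f \in A -> g \in A -> k f = b -> k g = a -> y f = y g ->
    S (x f) -> S (x g).
  move=> fA gA kf kg fg Sf; apply: connect_trans Sf (connect1 _).
  apply/exists_inP; exists f => //; apply/exists_inP; exists g => //.
  by rewrite kf kg fg !eqxx.
pose sw c := if c == a then b else if c == b then a else c.
have swinj c d : sw c = sw d -> c = d.
  rewrite /sw; case: (c =P a) => ?; case: (c =P b) => ?;
  case: (d =P a) => ?; case: (d =P b) => ?; congruence.
have swb c : sw c = b -> c = a by rewrite /sw; case: eqP => // ?; case: eqP; congruence.
(* Swapping [a] and [b] along the chain frees [b] at [x e] and keeps it free at [y e], so [e] can
   take color [b]. *)
pose k1 f := if S (x f) then sw (k f) else k f.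
have k1x f : f \in A -> x f = x e -> k1 f <> b.
  move=> fA fe; rewrite /k1 fe ifT; last exact: connect0.
  by move=> /swb; apply: ha.
have k1y f : f \in A -> y f = y e -> k1 f <> b.
  move=> fA fe; rewrite /k1; case: ifP => [Sf /swb kf|_]; last exact: hb.
  by have [h [hA kh yh _]] := Sa f fA kf Sf; apply: (hb h hA) => //; rewrite yh.
have k1p : proper_on A k1.
  split=> f g fA gA fg; rewrite /k1.
    by rewrite fg; case: ifP => _; [move=> /swinj|]; apply: px.
  (* A swapped edge and an unswapped one cannot clash at a common [y]-end: if the swapped edge had
     color [a] or [b], the chain would pass through the other edge too; otherwise its color is
     unchanged and the two edges coincide. *)
  have main f' g' : f' \in A -> g' \in A -> y f' = y g' ->
      S (x f') -> S (x g') = false -> sw (k f') = k g' -> False.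
    move=> fA' gA' fg' Sf /negP nSg; rewrite /sw.
    case: (k f' =P a) => [kf kg|_]; [|case: (k f' =P b) => [kf kg|_ kk]].
    - have [h [hA kh yh Sh]] := Sa f' fA' kf Sf; apply: nSg.
      by rewrite -(py h g') // ?yh // kh.
    - by apply: nSg; apply: (Sb f' g').
    - by apply: nSg; rewrite -(py f' g').
  case Sf: (S (x f)); case Sg: (S (x g)).
  - by move=> /swinj; apply: py.
  - by move=> /(main f g fA gA fg Sf Sg).
  - by move=> /esym /(main g f gA fA (esym fg) Sg Sf).
  - exact: py.
exists (fun f => if f == e then b else k1 f); split.
  move=> f; rewrite in_setU1; case: eqP => //= _ fA; rewrite /k1 /sw.
  by do 3?[case: ifP => // _]; apply: kD.
have [p1x p1y] := k1p.
split=> f g; rewrite !in_setU1; case: (f =P e) => [->|_]; case: (g =P e) => [->|_] //=.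
- by move=> _ gA /esym ge /esym/k1x; case.
- by move=> fA _ fe /k1x; case.
- exact: p1x.
- by move=> _ gA /esym ge /esym/k1y; case.
- by move=> fA _ fe /k1y; case.
- exact: p1y.
Qed.

Theorem konig_edge_coloring (D : nat) :
  (forall v, #|[set f | x f == v]| <= D) -> (forall w, #|[set f | y f == w]| <= D) ->
  exists k : E -> nat, (forall f, k f < D) /\ proper_on setT k.
Proof.
move=> dx dy.
suff H (A : {set E}) : exists k : E -> nat, (forall f, f \in A -> k f < D) /\ proper_on A k.
  by have [k [kD kp]] := H setT; exists k; split => // f; apply: kD; rewrite inE.
have [n] := ubnP #|A|; elim: n A => // n IH A; rewrite ltnS => leAn.
have [->|[e eA]] := set_0Vmem A.
  by exists (fun=> 0); split; [|split] => f; rewrite ?inE // => ?; rewrite inE.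
have [|k [kD kp]] := IH (A :\ e); first by move: leAn; rewrite (cardsD1 e A) eA.
by rewrite -(setD1K eA); apply: proper_extend kp => //; rewrite !inE eqxx.
Qed.

Definition beats (k : E -> nat) (f e : E) : bool :=
  (x f == x e) && (k f < k e) || (y f == y e) && (k e < k f).

(* Gale-Shapley: when the [x]-optimal edges [e] and [f] collide at their
   [y]-end, the loser [e] can be discarded, since whatever keeps [f] out of a
   kernel of the rest beats [e] as well. *)
Lemma kernel_exists (k : E -> nat) (A : {set E}) : proper_on A k ->
  exists F : {set E}, [/\ F \subset A, {in F &, injective x}, {in F &, injective y} &
    {in A :\: F, forall e, exists2 f, f \in F & beats k f e}].
Proof.
have [n] := ubnP #|A|; elim: n A => // n IH A; rewrite ltnS => leAn [px py].
pose M := [set e in A | [forall f in A, (x f == x e) ==> (k e <= k f)]].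
have Mmin e f : e \in M -> f \in A -> x f = x e -> k e <= k f.
  by rewrite inE => /andP[_ /forall_inP H] fA fe; have := H f fA; rewrite fe eqxx.
have MA : M \subset A by apply/subsetP => e; rewrite inE => /andP[].
have MAin e : e \in M -> e \in A by move/(subsetP MA).
have [/forall_inP Minj|] :=
    boolP [forall e in M, forall f in M, (y e == y f) ==> (e == f)].
  exists M; split => //.
  - move=> e f eM fM ef; apply: px; rewrite ?MAin //.
    by apply/eqP; rewrite eqn_leq !Mmin ?MAin.
  - move=> e f eM fM ef; have /forall_inP/(_ f fM) := Minj e eM.
    by rewrite ef eqxx => /eqP.
  move=> e; rewrite inE => /andP[eM eA].
  case: (@arg_minnP _ e [pred f in A | x f == x e] k) => [|f]; first by rewrite /= eA eqxx.
  move=> /andP[fA /eqP fe] fmin.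
  have fM : f \in M.
    rewrite inE fA; apply/forall_inP => g gA; apply/implyP => /eqP gf.
    by apply: fmin; rewrite /= gA gf fe eqxx.
  exists f => //; rewrite /beats fe eqxx /= ltn_neqAle Mmin // andbT.
  apply/orP; left; apply/eqP => kfe; case/negP: eM.
  by rewrite -(px f e).
case/forall_inPn => e0 e0M /forall_inPn[f0 f0M]; rewrite negb_imply => /andP[/eqP yef0 nef0].
have {nef0 e0M f0M yef0 e0 f0} [e [f [eM fM yef kef]]] :
    exists e f, [/\ e \in M, f \in M, y e = y f & k e < k f].
  case: (ltngtP (k e0) (k f0)) => kk; [by exists e0, f0|by exists f0, e0|].
  by case/eqP: nef0; apply: py; rewrite ?MAin.
have [||F [FA Fx Fy Fk]] := IH (A :\ e).
- by move: leAn; rewrite (cardsD1 e A) MAin.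
- by split=> g h /setD1P[_ gA] /setD1P[_ hA]; [apply: px|apply: py].
exists F; split => //; first exact: subset_trans FA (subsetDl _ _).
move=> g /setDP[gA gF]; have [->|ge] := eqVneq g e; last by apply: Fk; rewrite !inE gF ge.
have [fF|fF] := boolP (f \in F).
  by exists f => //; rewrite /beats yef eqxx kef orbT.
(* As [f] has the smallest color at its [x]-end, [h] must beat it at the [y]-end, which [e]
   shares. *)
have [|h hF] := Fk f.
  rewrite !inE fF MAin // andbT /=; apply/eqP => fe; move: kef; by rewrite fe ltnn.
have hA : h \in A by have /setD1P[] := subsetP FA h hF.
case/orP => /andP[/eqP hf kk].
  by have := Mmin f h fM hA hf; rewrite leqNgt kk.
by exists h => //; rewrite /beats yef hf eqxx (ltn_trans kef kk) orbT.
Qed.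

End BipartiteEdges.

(** * The on-line strategy on bipartite multigraphs *)

Lemma bipartite_ends (G : multigraph) : bipartite G ->
  exists x y : edge G -> vertex G,
    (forall e, ends e = [set x e; y e]) /\ forall e f, x e != y f.
Proof.
move=> [X GX].
have H (e : edge G) : exists p : vertex G * vertex G,
    [/\ ends e = [set p.1; p.2], p.1 \in X & p.2 \notin X].
  have [/eqP/cards1P[u uX] /eqP/cards1P[v vX]] := GX e.
  exists (u, v); split => /=.
  - by rewrite -[LHS](setID _ X) setDE uX vX.
  - by have := set11 u; rewrite -uX => /setIP[].
  - by have := set11 v; rewrite -vX => /setIP[_]; rewrite inE.
have [p Hp] := fin_all_exists H.
exists (fun e => (p e).1), (fun e => (p e).2); split=> [e|e f].
  by have [] := Hp e.
have [_ eX _] := Hp e; have [_ _ fX] := Hp f.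
by apply/eqP => ef; case/negP: fX; rewrite -ef.
Qed.

Lemma online_colorable_galvin (m : nat) (G : multigraph) (t : vertex G -> nat)
    (x y : edge G -> vertex G) (k : edge G -> nat) :
  (forall e, ends e = [set x e; y e]) -> (forall e f, x e != y f) ->
  proper_on x y setT k ->
  (forall e, #|[set f | beats x y k f e]| + t (x e) + t (y e) < m) ->
  online_colorable m t.
Proof.
elim: m G t x y k => [|m IH] G t x y k Gxy xNy [px py] bound.
  by apply: eq_card0 => e; have := bound e.
move=> U /subsetP Ut.
have [|F [FU Fx Fy Fk]] := @kernel_exists _ _ _ x y k (edges_outside U).
  by split=> f g _ _; [apply: px|apply: py]; rewrite inE.
exists F; split => //.
  move=> e f eF fF ef; rewrite !Gxy disjoints_subset.
  apply/subsetP => u; rewrite !inE negb_or => /orP[]/eqP->.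
    by rewrite xNy andbT; apply: contraNneq ef => /Fx->.
  by rewrite eq_sym xNy; apply: contraNneq ef => /Fy->.
apply: (IH (del_edges F) _ (fun e => x (val e)) (fun e => y (val e)) (fun e => k (val e))).
- by move=> e; apply: Gxy.
- by move=> e f; apply: xNy.
- by split=> f g _ _ fg kfg; apply: val_inj; [apply: px|apply: py]; rewrite ?inE.
move=> [e eF] /=; have := bound e; rewrite ltnS; apply: leq_trans.
set C := [set f | beats x y k f e].
(* Deleting [F] removes from the edges beating [e] exactly those in [F]. *)
have -> : #|[set f : {f | f \notin F} | beats (fun e => x (val e)) (fun e => y (val e))
     (fun e => k (val e)) f (Sub e eF)]| = #|C :\: F|.
  rewrite -(card_imset _ val_inj); apply: eq_card => f.
  apply/imsetP/setDP => [[g gC ->]|[fC fF]].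
    by split; [move: gC; rewrite !inE|exact: (valP g)].
  by exists (Sub f fF) => //; move: fC; rewrite !inE.
have leC : #|C :\: F| <= #|C| by rewrite subset_leq_card ?subsetDl.
rewrite /sub_indicator; have [eU|] := boolP [disjoint ends e & U].
  have [|f fF fe] := Fk e; first by rewrite !inE eF eU.
  have : #|C :\: F| < #|C|.
    apply: proper_card; apply/properP; split; first exact: subsetDl.
    by exists f; rewrite !inE ?fF ?fe.
  lia.
(* Here [e] meets [U]. As [U] lies in the support of [t], the truncated subtraction lowers [t u] by
   a full unit. *)
case/pred0Pn => u /= /andP[]; rewrite Gxy !inE => /orP[]/eqP-> uU;
  have := Ut _ uU; rewrite inE uU /=; lia.
Qed.

(** * From on-line play to off-line avoiding colorings *)

Lemma online_colorable_label (m : nat) (G : multigraph) (t : vertex G -> nat)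
    (c : vertex G -> pred nat) :
  online_colorable m t -> (forall v, \sum_(i < m) c v i <= t v) ->
  exists col : edge G -> nat, [/\ forall e, col e < m,
    forall e f, e != f -> ~~ [disjoint ends e & ends f] -> col e <> col f &
    forall e v, v \in ends e -> ~~ c v (col e)].
Proof.
elim: m G t c => [|m IH] G t c /=.
  move=> G0 _; have noE (e : edge G) : False by have := card0_eq G0 e.
  by exists (fun=> 0); split=> e; case: (noE e).
(* Label 0 stands for the current round; the later rounds see the labels shifted down by one. Only
   labels below [m] count against [t], one for each remaining round. *)
move=> play ct; have ct' v := ct v; pose U := [set v | c v 0].
have [|F [FU Find rest]] := play U.
  apply/subsetP => v; rewrite !inE => cv; have := ct' v.
  by rewrite big_ord_recl cv -lt0n; apply: leq_trans.
have [v|col [colm colp colc]] := IH (del_edges F) _ (fun v i => c v i.+1) rest.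
  have := ct' v; rewrite big_ord_recl /sub_indicator inE => ctv.
  by rewrite leq_subRL //; apply: leq_trans ctv; rewrite leq_addr.
(* Edges removed in this round get color 0; the others get their later color, shifted back up. *)
pose col' e := if insub e is Some e' then (col e').+1 else 0.
have col'P e : (e \in F /\ col' e = 0) \/
    exists2 e' : edge (del_edges F), e = val e' & col' e = (col e').+1.
  by rewrite /col'; case: insubP => [e' _ <-|/negPn]; [right; exists e'|left].
exists col'; split.
- by move=> e; case: (col'P e) => [[_ ->]|[e' _ ->]] //; apply: colm.
- move=> e f ef nd; case: (col'P e) => [[eF ->]|[e' ee ->]];
    case: (col'P f) => [[fF ->]|[f' ff ->]] //.
    by case/negP: nd; apply: Find.
  move=> [cef]; apply: (colp e' f') cef; last by move: nd; rewrite ee ff.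
  by apply: contraNneq ef => ef; rewrite ee ff ef.
- move=> e v ve; case: (col'P e) => [[eF ->]|[e' ee ->]]; last first.
    by apply: colc; rewrite /= -ee.
  have := subsetP FU e eF; rewrite inE => /pred0P/(_ v) /=.
  by rewrite ve inE /= => ->.
Qed.

Lemma online_colorable_avoiding (m : nat) (G : multigraph) (t : nat)
    (c : vertex G -> set nat) :
  @online_colorable m G (fun=> t) -> t_labeling t c ->
  exists col : edge G -> nat, edge_coloring m col /\ avoids c col.
Proof.
move=> play [_ ct]; have [v|col [colm colp colc]] :=
    online_colorable_label (c := fun v i => `[< c v i.+1 >]) play.
  have /ppcard_leP[f] := ct v.
  rewrite (_ : \sum_(i < m) _ = #|[set i : 'I_m | `[< c v i.+1 >]]|); last first.
    by rewrite -sum1dep_card [RHS]big_mkcond; apply: eq_bigr => i _; case: asboolP.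
  apply: (@card_le_range _ _ (fun i : 'I_m => f i.+1) 0) => [i j|i].
    rewrite !inE => /asboolP ci /asboolP cj fij; apply: val_inj; apply: succn_inj.
    by apply: (@inj _ _ _ f) => //; apply: mem_set.
  by rewrite inE => /asboolP ci; apply: (@funS _ _ _ _ f).
exists (fun e => (col e).+1); split; first split => [e|e f ef nd [/(colp e f ef nd)]//].
  exact: colm.
by move=> e [v /= ve cv]; case/negP: (colc e v ve); apply/asboolP.
Qed.

(** * Lower bounds from the degree of a vertex *)

(** The edges at [v] have distinct colors in the interval from [a + 1] to [m]. Positivity of the
    degree rules out [m <= a], where [m - a] would truncate. *)
Lemma degree_add_le (G : multigraph) (v : vertex G) (a m : nat) (col : edge G -> nat) :
  edge_coloring m col -> 0 < degree v -> (forall e, v \in ends e -> a < col e) ->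
  degree v + a <= m.
Proof.
move=> [colm colp] dv cola.
have : degree v <= m - a.
  apply: (@card_le_range _ _ col a.+1) => [e f|e]; rewrite !inE => ve.
    move=> vf ef; apply/eqP/negPn/negP => /colp; apply => //.
    by apply/negP => /pred0P/(_ v) /=; rewrite ve vf.
  by have := cola e ve; have /andP[_] := colm e; lia.
lia.
Qed.

Lemma t_labeling_forcing (G : multigraph) (v : vertex G) (t : nat) : 0 < degree v ->
  exists2 c : vertex G -> set nat, t_labeling t c &
    forall m col, edge_coloring m col -> avoids c col -> degree v + 2 * t <= m.
Proof.
move=> dv; pose s u := if u == v then 1 else t.+1.
exists (fun u => [set i + s u | i in `I_t]%classic); first split.
- by move=> u _ [i _ <-]; rewrite /s /=; case: ifP => _; rewrite addnS.
- by move=> u; apply: card_image_le.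
move=> m col colm av; apply: (degree_add_le colm dv) => e ve; rewrite ltnNge.
have col0 : 0 < col e by case: colm => /(_ e)/andP[].
(* A color up to [t] is in the label of [v]; one from [t + 1] to [2 * t] is in the label of the
   other end [u] of [e]. *)
apply/negP => le2t; apply: (av e); have [le|lt] := leqP (col e) t.
  exists v => //=; exists (col e).-1; rewrite /s ?eqxx; lia.
have : 0 < #|ends e :\ v| by have := card_ends e; rewrite (cardsD1 v) ve; lia.
case/card_gt0P => u; rewrite !inE => /andP[uv ue].
by exists u => //=; exists (col e - t.+1); rewrite /s ?(negPf uv); lia.
Qed.

(** * Colorings with [max_degree] colors, and equality of the indices *)

Lemma bipartite_edge_coloring (G : multigraph) (x y : edge G -> vertex G) :
  (forall e, ends e = [set x e; y e]) ->
  exists k : edge G -> nat, (forall e, k e < max_degree G) /\ proper_on x y setT k.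
Proof.
move=> Gxy; apply: konig_edge_coloring => v; apply: leq_trans (leq_bigmax v);
  apply: subset_leq_card; apply/subsetP => e; rewrite !inE Gxy !inE => /eqP->;
  by rewrite eqxx ?orbT.
Qed.

Lemma proper_on_edge_coloring (G : multigraph) (x y : edge G -> vertex G)
    (D : nat) (k : edge G -> nat) :
  (forall e, ends e = [set x e; y e]) -> (forall e f, x e != y f) ->
  (forall e, k e < D) -> proper_on x y setT k -> edge_coloring D (fun e => (k e).+1).
Proof.
move=> Gxy xNy kD [px py]; split => // e f /eqP ef /pred0Pn[u /andP[/=]].
rewrite !Gxy !inE => /orP[]/eqP-> /orP[] /eqP uf [kef]; apply: ef.
- by apply: px; rewrite ?inE.
- by have := xNy e f; rewrite uf eqxx.
- by have := xNy f e; rewrite uf eqxx.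
- by apply: py; rewrite ?inE.
Qed.

(** The opposite orders on the two sides make the counts complementary: edges beating [e] at [x e]
    have distinct colors below [k e], those at [y e] distinct colors above it, so together they
    number at most [D - 1]. *)
Lemma card_beats (E V W : finType) (x : E -> V) (y : E -> W) (k : E -> nat)
    (D : nat) (e : E) :
  proper_on x y setT k -> (forall f, k f < D) -> #|[set f | beats x y k f e]| < D.
Proof.
move=> [px py] kD.
have cx : #|[set f | (x f == x e) && (k f < k e)]| <= k e.
  apply: (@card_le_range _ _ k 0) => [f g|f]; rewrite !inE; last by case/andP.
  move=> /andP[/eqP fe _] /andP[/eqP ge _].
  by apply: px; rewrite ?inE // fe ge.
have cy : #|[set f | (y f == y e) && (k e < k f)]| <= D - (k e).+1.
  apply: (@card_le_range _ _ k (k e).+1) => [f g|f]; rewrite !inE.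
    move=> /andP[/eqP fe _] /andP[/eqP ge _].
    by apply: py; rewrite ?inE // fe ge.
  by move=> /andP[_ ->]; rewrite subnKC ?kD.
have -> : [set f | beats x y k f e] = [set f | (x f == x e) && (k f < k e)]
    :|: [set f | (y f == y e) && (k e < k f)] by apply/setP => f; rewrite !inE.
apply: leq_ltn_trans (leq_card_setU _ _) _.
by have := kD e; lia.
Qed.

Lemma eq_least (P : set nat) (m : nat) :
  P m -> (forall k, P k -> m <= k) -> least P = m.
Proof.
move=> Pm minm; have [Pl minl] := least_spec (ex_intro _ m Pm).
by apply/eqP; rewrite eqn_leq minl ?minm.
Qed.

Theorem theorem3p4 (B : multigraph) (t : nat)
    (Bbip : bipartite B) (Bedge : 0 < #|edge B|) :
  online_index (G := B) (fun=> t) = t_avoiding_index B t /\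
  t_avoiding_index B t = chromatic_index B + 2 * t /\
  chromatic_index B + 2 * t = max_degree B + 2 * t.
Proof.
have [x [y [Bxy xNy]]] := bipartite_ends Bbip.
have [k [kD kp]] := bipartite_edge_coloring Bxy.
have [e0 _] := card_gt0P Bedge.
have D0 : 0 < max_degree B by apply: leq_ltn_trans (kD e0).
have [v vD] : exists v : vertex B, max_degree B = degree v.
  by have [|v] := @eq_bigmax _ (@degree B) _; [apply/card_gt0P; exists (x e0)|exists v].
have dv : 0 < degree v by rewrite -vD.
have play : @online_colorable (max_degree B + 2 * t) B (fun=> t).
  apply: (online_colorable_galvin Bxy xNy kp) => e.
  by have := card_beats e kp kD; lia.
have [c ct cm] := t_labeling_forcing t dv.
have -> : chromatic_index B = max_degree B.
  apply: eq_least => [|m [_ [col colm]]].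
    by split => //; eexists; apply: proper_on_edge_coloring kD kp.
  rewrite vD -[degree v]addn0; apply: (degree_add_le colm dv) => e _.
  by case: colm => /(_ e)/andP[].
have -> : online_index (G := B) (fun=> t) = max_degree B + 2 * t.
  apply: eq_least => [//|m /online_colorable_avoiding/(_ ct)[col [colm av]]].
  by rewrite vD; apply: cm colm av.
suff -> : t_avoiding_index B t = max_degree B + 2 * t by [].
have ic : avoiding_index c = max_degree B + 2 * t.
  apply: eq_least => [|m [_ [col [colm av]]]]; last by rewrite vD; apply: cm colm av.
  split; first by rewrite addn_gt0 D0.
  exact: online_colorable_avoiding play ct.
(* The maximum is attained by some labeling [c'], whose index the on-line strategy bounds from
   above; [c] attains this bound. *)
rewrite /t_avoiding_index; have [[c' c't ->] maxl] := greatest_spec (t_avoiding_index_ex B t) (@t_avoiding_index_bound B t).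
apply/eqP; rewrite eqn_leq; apply/andP; split; last by apply: maxl; exists c.
have [_] := least_spec (avoiding_index_wd c't); apply; split; first by rewrite addn_gt0 D0.
exact: online_colorable_avoiding play c't.
Qed.
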